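(* Let $X=(X^x)_{x\in\mathbb{R}}$ be a deterministic Hunt process on $\mathbb{R}$, with decomposition $(J_j)_j$ of $\mathbb{R}$ and generating paths $\Phi_j:I_j\to J_j$. Then $X$ is a Feller process if and only if both of the following hold: (1) either $X$ is of pure type, or every pair of neighbouring domains in its structure (written lower domain $|$ upper domain) is one of the building blocks $\oplus|\odot$, $\odot|\ominus$, or $\odot|\oplus$ with the left endpoint of $I_\oplus$ equal to $-\infty$, or $\ominus|\odot$ with the left endpoint of $I_\ominus$ equal to $-\infty$; (2) if there is a lowest domain $J_{-n}$ and it is a $\oplus$-domain, then the left endpoint of $I_{-n}$ is $-\infty$; and if there is a highest domain $J_m$ and it is a $\ominus$-domain, then the left endpoint of $I_m$ is $-\infty$.
   Context: A deterministic Markov process on $\mathbb{R}$ is a family $(X^x)_{x\in\mathbb{R}}$ of functions $t\mapsto X_t^x\in\mathbb{R}$, $t\in[0,\infty)$, with $X_0^x=x$ and such that $X_s^x=X_t^y$ implies $X_{s+h}^x=X_{t+h}^y$ for every $h\ge 0$. It is a Hunt process if it is càdlàg and quasi-left continuous, which here means that all paths are continuous. Structure: a deterministic Hunt process is described by a decomposition of $\mathbb{R}$ into disjoint ordered intervals $(J_j)_{j\in Z}$, $Z=\{-n,\dots,m\}$ a set of consecutive integers with $n,m\in\mathbb{N}\cup\{\infty\}$ ($J_i$ lies below $J_j$ for $i<j$), such that on each $J_j$ either all paths $t\mapsto X^x_t$, $x\in J_j$, are constant (then $J_j$, possibly a single point, is a $\odot$-domain), or there is a continuous, surjective, strictly monotone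 generating path $\Phi_j:I_j\to J_j$, $I_j$ an interval containing $0$, with $X_t^x=\Phi_j(t+\Phi_j^{-1}(x))$ for $x\in J_j$ and $t\in[0,\infty)\cap(I_j-\Phi_j^{-1}(x))$; then $J_j$ is a $\oplus$-domain if $\Phi_j$ is increasing and a $\ominus$-domain if $\Phi_j$ is decreasing, and one writes $\Phi_\oplus:I_\oplus\to J_\oplus$, $\Phi_\ominus:I_\ominus\to J_\ominus$. If the right endpoint of $I_j$ is finite, then paths from $J_j$ reach in finite time the adjacent endpoint of the neighbouring $\odot$-domain (above for $\oplus$, below for $\ominus$) and stay there forever. Neighbouring $\odot$-domains are merged into one. The sequence of types of the domains in increasing order is the structure of the process; the process is of pure type if there is only one domain. The semigroup is $T_tu(x)=u(X_t^x)$. Let $C_\infty(\mathbb{R})$ be the continuous functions vanishing at infinity. $X$ is a Feller process if $(F1)$ $T_t$ maps $C_\infty(\mathbb{R})$ into $C_\infty(\mathbb{R})$ for every $t\ge0$ and $(F2)$ $\lim_{t\downarrow0}\|T_tu-u\|_\infty=0$ for every $u\in C_\infty(\mathbb{R})$. *)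

(* Defs.v *)
From HB Require Import structures.
From mathcomp Require Import all_boot all_order all_algebra.
From mathcomp Require Import all_classical all_reals all_analysis.

Set Implicit Arguments.
Unset Strict Implicit.
Unset Printing Implicit Defensive.

Import Order.TTheory GRing.Theory Num.Theory.
Import numFieldNormedType.Exports.

Local Open Scope classical_set_scope.
Local Open Scope ring_scope.

(* A process is [X : R -> R -> R], where [X x t] is the position at time [t]
   of the path started at [x]. Only its values at times [0 <= t] are ever used. *)

Definition deterministic_markov (R : realType) (X : R -> R -> R) : Prop :=
  (forall x, X x 0 = x) /\
  (forall x y s t h, 0 <= s -> 0 <= t -> 0 <= h ->
     X x s = X y t -> X x (s + h) = X y (t + h)).

(* For deterministic processes, cadlag and quasi-left continuous means that
   all paths are continuous on [0, +oo[. *)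
Definition deterministic_hunt (R : realType) (X : R -> R -> R) : Prop :=
  deterministic_markov X /\
  (forall x, {within `[0, +oo[, continuous (X x)}).

Definition semigroup (R : realType) (X : R -> R -> R) (t : R) (u : R -> R)
  : R -> R := fun x => u (X x t).

Definition C_infty (R : realType) : set (R -> R) :=
  [set u | continuous u /\
           (u x @[x --> +oo] --> (0 : R)) /\ (u x @[x --> -oo] --> (0 : R))].

Definition sup_norm (R : realType) (f : R -> R) : \bar R :=
  ereal_sup [set `|f x|%:E | x in [set: R]].

Definition feller (R : realType) (X : R -> R -> R) : Prop :=
  (forall t u, 0 <= t -> C_infty u -> C_infty (semigroup X t u)) /\
  (forall u, C_infty u ->
     sup_norm (semigroup X t u \- u) @[t --> 0^'+] --> 0%E).

Definition left_end (R : realType) (I : set R) : \bar R :=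
  ereal_inf [set t%:E | t in I].

Definition right_end (R : realType) (I : set R) : \bar R :=
  ereal_sup [set t%:E | t in I].

Inductive domain_type := Odot | Oplus | Ominus.

(* The index set is {-n, ..., m}, where [lowest] is [Some n], or [None] if n is
   infinite, and [highest] is [Some m], or [None] if m is infinite.
   [time_itv j] and [Phi j] are I_j and Phi_j; they carry no information when
   [dtype j = Odot]. *)
Record domains (R : realType) := Domains {
  lowest : option nat;
  highest : option nat;
  domain : int -> set R;
  dtype : int -> domain_type;
  time_itv : int -> set R;
  Phi : int -> R -> R }.

Definition indices (R : realType) (D : domains R) : set int :=
  [set j | (if lowest D is Some n then - n%:Z <= j else True) /\
           (if highest D is Some m then j <= m%:Z else True)].

Definition ordered_partition (R : realType) (D : domains R) : Prop :=
  (forall j, indices D j -> is_interval (domain D j) /\ domain D j !=set0) /\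
  (forall i j x y, indices D i -> indices D j -> i < j ->
     domain D i x -> domain D j y -> x < y) /\
  \bigcup_(j in indices D) domain D j = [set: R].

Definition constant_paths (R : realType) (X : R -> R -> R) (J : set R) : Prop :=
  forall x t, J x -> 0 <= t -> X x t = x.

(* [pinv I Phi] is the inverse Phi^-1 : J -> I of the bijection Phi : I -> J. *)
Definition generates (R : realType) (X : R -> R -> R)
    (I J : set R) (Phi : R -> R) : Prop :=
  [/\ is_interval I, I 0,
      {within I, continuous Phi},
      Phi @` I = J &
      forall x t, J x -> 0 <= t -> I (t + pinv I Phi x) ->
        X x t = Phi (t + pinv I Phi x)].

Definition increasing_on (R : realType) (I : set R) (Phi : R -> R) : Prop :=
  forall s t, I s -> I t -> s < t -> Phi s < Phi t.

Definition decreasing_on (R : realType) (I : set R) (Phi : R -> R) : Prop :=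
  forall s t, I s -> I t -> s < t -> Phi t < Phi s.

Definition absorbed (R : realType) (X : R -> R -> R) (J : set R) (e : R) : Prop :=
  forall x, J x -> exists2 t0, 0 <= t0 & forall t, t0 <= t -> X x t = e.

Definition domain_spec (R : realType) (X : R -> R -> R) (D : domains R) (j : int)
  : Prop :=
  match dtype D j with
  | Odot => constant_paths X (domain D j)
  | Oplus =>
      [/\ generates X (time_itv D j) (domain D j) (Phi D j),
          increasing_on (time_itv D j) (Phi D j) &
          right_end (time_itv D j) \is a fin_num ->
          [/\ indices D (j + 1), dtype D (j + 1) = Odot &
              exists e, [/\ domain D (j + 1) e,
                            lbound (domain D (j + 1)) e &
                            absorbed X (domain D j) e]]]
  | Ominus =>
      [/\ generates X (time_itv D j) (domain D j) (Phi D j),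
          decreasing_on (time_itv D j) (Phi D j) &
          right_end (time_itv D j) \is a fin_num ->
          [/\ indices D (j - 1), dtype D (j - 1) = Odot &
              exists e, [/\ domain D (j - 1) e,
                            ubound (domain D (j - 1)) e &
                            absorbed X (domain D j) e]]]
  end.

Definition odot_merged (R : realType) (D : domains R) : Prop :=
  forall j, indices D j -> indices D (j + 1) ->
    ~ (dtype D j = Odot /\ dtype D (j + 1) = Odot).

Definition decomposition (R : realType) (X : R -> R -> R) (D : domains R) : Prop :=
  [/\ ordered_partition D,
      forall j, indices D j -> domain_spec X D j &
      odot_merged D].

Definition pure_type (R : realType) (D : domains R) : Prop :=
  forall i j, indices D i -> indices D j -> i = j.

(* The pair of the domains [j] (lower) and [j + 1] (upper). *)
Definition building_block (R : realType) (D : domains R) (j : int) : Prop :=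
  match dtype D j, dtype D (j + 1) with
  | Oplus, Odot => True
  | Odot, Ominus => True
  | Odot, Oplus => left_end (time_itv D (j + 1)) = -oo%E
  | Ominus, Odot => left_end (time_itv D j) = -oo%E
  | _, _ => False
  end.

(* Main.v *)
(* Two paths that meet coincide afterwards, so by the intermediate value
   theorem x |-> X x t is nondecreasing. This already yields strong continuity,
   and a nondecreasing map f satisfies u \o f \in C_infty for all u \in C_infty
   exactly when it is surjective. So X is Feller iff every X^~ t is surjective.
   A path starting in a domain stays there or ends up in an Odot-domain, hence a
   point of an Oplus- or Ominus-domain is reached at all times iff the left end
   of the time interval is -oo. In that case, two neighbouring moving domains
   would both lack the common boundary point, so one neighbour is Odot. *)

Require Import Defs.
From HB Require Import structures.
From mathcomp Require Import all_boot all_order all_algebra.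
From mathcomp Require Import all_classical all_reals all_analysis.
From mathcomp Require Import lra zify.
Set Implicit Arguments.
Unset Strict Implicit.
Unset Printing Implicit Defensive.
Import Order.TTheory GRing.Theory Num.Theory.
Import numFieldNormedType.Exports.
Local Open Scope classical_set_scope.
Local Open Scope ring_scope.

(** * Crossing and recurrence of paths *)

Lemma path_ivt (R : realType) (X : R -> R -> R) (x a b y : R) :
  deterministic_hunt X -> 0 <= a -> a <= b -> X x a <= y -> y <= X x b ->
  exists2 s, a <= s <= b & X x s = y.
Proof.
move=> [_ Xc] a0 ab ay yb.
have [||s] := @IVT R (X x) a b y ab.
- apply: continuous_subspaceW (Xc x) => s /=; rewrite !in_itv /= => /andP[as_ _].
  by rewrite (le_trans a0 as_).
- by rewrite ge_min ay le_max yb orbT.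
- by rewrite in_itv => sab Xs; exists s.
Qed.

Lemma path_monotone (R : realType) (X : R -> R -> R) (x y t : R) :
  deterministic_hunt X -> 0 <= t -> x <= y -> X x t <= X y t.
Proof.
move=> [[X0 Xm] Xc] t0 xy; rewrite leNgt; apply/negP => yx.
have sub z : {within `[0, t], continuous (X z)}.
  by apply: continuous_subspaceW (Xc z) => s /=; rewrite !in_itv /= => /andP[->].
have [|s] := IVT t0 (within_continuousB (sub y) (sub x)) (v := 0).
  by rewrite !fctE !X0 ge_min le_max !subr_ge0 !subr_le0 xy (ltW yx) orbT.
rewrite in_itv /= => /andP[s0 st] /eqP; rewrite subr_eq0 => /eqP yxs.
have ts0 : 0 <= t - s by rewrite subr_ge0.
have := Xm y x s s (t - s) s0 s0 ts0 yxs.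
by rewrite subrKC => yxt; rewrite yxt ltxx in yx.
Qed.

(** By the Markov property the path has period [t - s] from time [s] on, so its value at [s] recurs
    at arbitrarily late times, when it equals [e]. *)
Lemma periodic_path_absorbed (R : realType) (X : R -> R -> R) (x e s t : R) :
  deterministic_markov X -> 0 <= s -> s < t -> X x s = X x t ->
  (exists2 t0, 0 <= t0 & forall r, t0 <= r -> X x r = e) -> X x s = e.
Proof.
move=> [_ Xm] s0 st Xst [t0 t00 Xe].
have t_ge0 : 0 <= t by exact: le_trans s0 (ltW st).
have d0 : 0 < t - s by rewrite subr_gt0.
have per n : X x (s + (t - s) *+ n) = X x s.
  elim: n => [|n IH]; first by rewrite mulr0n addr0.
  have h0 : 0 <= (t - s) *+ n by rewrite mulrn_wge0 // ltW.
  rewrite mulrS addrA [s + _]subrKC.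
  by rewrite -(Xm _ _ _ _ _ s0 t_ge0 h0 Xst).
have [n tn] : exists n, t0 <= (t - s) *+ n.
  exists (Num.truncn (t0 / (t - s))).+1.
  by rewrite -mulr_natl -ler_pdivrMr // ltW // truncnS_gt.
by rewrite -(per n) Xe // (le_trans tn) // lerDr.
Qed.

(** * Motion inside a moving domain and exit from it *)

(** The flow law of [generates] in the time parameter, which removes [pinv]. *)
Definition flows_along (R : realType) (X : R -> R -> R) (I : set R)
    (Phi : R -> R) : Prop :=
  forall s t, I s -> 0 <= t -> I (s + t) -> X (Phi s) t = Phi (s + t).

Lemma generates_flows (R : realType) (X : R -> R -> R) (I J : set R)
    (Phi : R -> R) :
  {in I &, injective Phi} -> generates X I J Phi -> flows_along X I Phi.
Proof.
move=> inj [_ _ _ IJ gen] s t Is t0 Ist.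
have ps : pinv I Phi (Phi s) = s by apply: pinvKV => //; rewrite inE.
have Js : J (Phi s) by rewrite -IJ; exists s.
by have := gen (Phi s) t Js t0; rewrite ps [t + s]addrC; apply.
Qed.

Lemma increasing_inj (R : realType) (I : set R) (Phi : R -> R) :
  increasing_on I Phi -> {in I &, injective Phi}.
Proof.
move=> inc s t; rewrite !inE => Is It eqP.
by case: (ltgtP s t) => // [/(inc _ _ Is It)|/(inc _ _ It Is)]; rewrite eqP ltxx.
Qed.

Lemma decreasing_inj (R : realType) (I : set R) (Phi : R -> R) :
  decreasing_on I Phi -> {in I &, injective Phi}.
Proof.
move=> dec s t; rewrite !inE => Is It eqP.
by case: (ltgtP s t) => // [/(dec _ _ Is It)|/(dec _ _ It Is)]; rewrite eqP ltxx.
Qed.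

(** [absorbed] only places the path at [e] eventually; here it is at [e] as soon as its time
    parameter leaves [I]. Monotonicity keeps it from exceeding [e], and if it were lower, some value
    below [e] would be taken twice, making the path periodic against absorption. *)
Lemma exit_increasing (R : realType) (X : R -> R -> R) (I : set R)
    (Phi : R -> R) (e : R) :
  deterministic_hunt X -> is_interval I -> flows_along X I Phi ->
  increasing_on I Phi -> (forall t, 0 <= t -> X e t = e) ->
  (forall s, I s -> Phi s < e) ->
  (forall s z, I s -> Phi s <= z -> z < e -> (Phi @` I) z) ->
  absorbed X (Phi @` I) e ->
  forall s t, I s -> 0 <= t -> ~ I (s + t) -> X (Phi s) t = e.
Proof.
move=> hX itvI flow inc rest below fill abs s t Is t0 nI.
have X0 := hX.1.1.
have absS : exists2 t1, 0 <= t1 & forall r, t1 <= r -> X (Phi s) r = e.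
  by apply: abs; exists s.
have ze : X (Phi s) t <= e.
  by rewrite -[leRHS](rest t t0); apply: path_monotone => //; exact/ltW/below.
have t_gt0 : 0 < t.
  rewrite lt_neqAle t0 andbT; apply/eqP => t00; apply: nI.
  by rewrite -t00 addr0.
move: ze; rewrite le_eqVlt => /orP[/eqP//|ze].
have [zs|sz] := ltP (X (Phi s) t) (Phi s).
  (* Below its start, the path has to cross [Phi s] again on its way up to [e], which it has reached
     by time [Num.max t t1]. *)
  have [t1 _ Xe] := absS.
  have [||r /andP[tr _] Xr] :=
    @path_ivt R X (Phi s) t (Num.max t t1) (Phi s) hX t0 _ (ltW zs).
  - by rewrite le_max lexx.
  - by rewrite Xe ?le_max ?lexx ?orbT //; exact/ltW/below.
  have := periodic_path_absorbed hX.1 (lexx 0) (lt_le_trans t_gt0 tr).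
  move=> /(_ (Phi s) e); rewrite X0 Xr => /(_ erefl absS) se.
  by have := below s Is; rewrite se ltxx.
(* Otherwise the value is some [Phi q] with [s <= q < s + t], already visited at time
   [q - s < t]. *)
have [q Iq qz] := fill s _ Is sz ze.
have sq : s <= q.
  rewrite leNgt; apply/negP => qs.
  by have := inc _ _ Iq Is qs; rewrite qz ltNge sz.
have qst : q < s + t.
  rewrite ltNge; apply/negP => stq; apply: nI.
  by apply: (itvI s q) => //; rewrite stq lerDl t0.
have qs0 : 0 <= q - s by rewrite subr_ge0.
have qst' : q - s < t by rewrite ltrBlDl.
have Xq : X (Phi s) (q - s) = X (Phi s) t.
  by rewrite flow // subrKC.
by rewrite -Xq; exact: periodic_path_absorbed hX.1 qs0 qst' Xq absS.
Qed.

(** Reflection exchanges increasing and decreasing generating paths, which reduces downward exits to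
    upward ones. *)
Lemma reflect_hunt (R : realType) (X : R -> R -> R) :
  deterministic_hunt X -> deterministic_hunt (fun x t => - X (- x) t).
Proof.
move=> [[X0 Xm] Xc]; split; first split.
- by move=> x; rewrite X0 opprK.
- move=> x y s t h s0 t0 h0 /oppr_inj Xst.
  by congr (- _); exact: Xm Xst.
- by move=> x s; apply: continuousN; exact: Xc.
Qed.

Lemma exit_decreasing (R : realType) (X : R -> R -> R) (I : set R)
    (Phi : R -> R) (e : R) :
  deterministic_hunt X -> is_interval I -> flows_along X I Phi ->
  decreasing_on I Phi -> (forall t, 0 <= t -> X e t = e) ->
  (forall s, I s -> e < Phi s) ->
  (forall s z, I s -> z <= Phi s -> e < z -> (Phi @` I) z) ->
  absorbed X (Phi @` I) e ->
  forall s t, I s -> 0 <= t -> ~ I (s + t) -> X (Phi s) t = e.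
Proof.
move=> hX itvI flow dec rest above fill abs s t Is t0 nI.
apply: oppr_inj; rewrite -{1}(opprK (Phi s)).
apply: (@exit_increasing R (fun x r => - X (- x) r) I (fun r => - Phi r)) => //.
- exact: reflect_hunt.
- by move=> r h Ir h0 Irh; rewrite opprK flow.
- by move=> r r' Ir Ir' rr'; rewrite ltrN2; exact: dec.
- by move=> r r0; rewrite opprK rest.
- by move=> r Ir; rewrite ltrN2; exact: above.
- move=> r z Ir rz ze; have [|| q Iq qz] := fill r (- z) Ir.
  + by rewrite lerNl.
  + by rewrite ltrNr.
  by exists q => //; rewrite qz opprK.
- move=> _ [r Ir <-]; have [|t1 t10 Xe] := abs (Phi r); first by exists r.
  by exists t1 => // h t1h; rewrite opprK Xe.
Qed.

(** * Composition of [C_infty] functions with nondecreasing maps *)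

(** Test function for surjectivity: it has the sign of [z - c], and away from [c] it tends to zero
    only at infinity. *)
Lemma bump_C_infty (R : realType) (c : R) :
  C_infty (fun z => (z - c) / (1 + (z - c) ^+ 2)).
Proof.
have pos z : 0 < 1 + (z - c) ^+ 2 by rewrite ltr_wpDr ?sqr_ge0.
have small e z : 0 < e -> e^-1 <= `|z - c| ->
    `|0 - (z - c) / (1 + (z - c) ^+ 2)| <= e.
  move=> e0 ez; rewrite sub0r normrN normrM normfV (gtr0_norm (pos z)).
  rewrite ler_pdivrMr // -(real_normK (num_real (z - c))).
  move: (`|z - c|) ez => d ed.
  have ed1 : 1 <= e * d by rewrite -ler_pdivrMl // mulr1.
  have : 0 <= d by apply: le_trans ed; rewrite invr_ge0 ltW.
  by nra.
split; [|split].
- move=> z; apply: cvgM; first by apply: cvgB; [exact: cvg_id|exact: cvg_cst].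
  apply: cvgV; first by rewrite gt_eqF.
  apply: cvgD; first exact: cvg_cst.
  by apply: cvgM; (apply: cvgB; [exact: cvg_id|exact: cvg_cst]).
- apply/cvgrPdist_le => e e0; near=> z; apply: small => //.
  have cz : c + e^-1 <= z by near: z; exact: (nbhs_pinfty_ge (num_real _)).
  by apply: le_trans (ler_norm _); rewrite lerBrDl.
- apply/cvgrPdist_le => e e0; near=> z; apply: small => //.
  have cz : z <= c - e^-1 by near: z; exact: (nbhs_ninfty_le (num_real _)).
  by rewrite distrC; apply: le_trans (ler_norm _); rewrite lerBrDr addrC -lerBrDr.
Unshelve. all: by end_near. Qed.

Lemma surjective_C_infty (R : realType) (f u : R -> R) :
  {homo f : x y / x <= y} -> (forall y, exists x, f x = y) ->
  C_infty u -> C_infty (u \o f).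
Proof.
move=> fm fs [uc [uy uNy]]; split; [|split].
- suff fc : continuous f by move=> x; apply: continuous_comp; [exact: fc|exact: uc].
  move=> x; apply/cvgrPdist_le => e e0.
  (* Preimages of [f x - e] and [f x + e] bracket [x] strictly, so monotonicity yields
     continuity. *)
  have [a fa] := fs (f x - e); have [b fb] := fs (f x + e).
  have ax : a < x by rewrite ltNge; apply/negP => /fm; rewrite fa; lra.
  have xb : x < b by rewrite ltNge; apply/negP => /fm; rewrite fb; lra.
  near=> y; rewrite ler_distlC -fa -fb; apply/andP; split; apply: fm.
    by near: y; exact: lt_le_nbhsr.
  by near: y; exact: lt_le_nbhsl.
- apply: cvg_comp uy; apply/cvgryPge => A; have [a fa] := fs A.
  by near=> x; rewrite -fa; apply: fm; near: x; exact: (nbhs_pinfty_ge (num_real _)).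
- apply: cvg_comp uNy; apply/cvgrNyPle => A; have [a fa] := fs A.
  by near=> x; rewrite -fa; apply: fm; near: x; exact: (nbhs_ninfty_le (num_real _)).
Unshelve. all: by end_near. Qed.

(** If [f] stayed below [y], monotonicity would confine [f x] for [x >= 0] to [[f 0, y[], where the
    bump centred at [y + 1] is bounded away from zero, so the composite could not vanish at
    [+oo]. *)
Lemma C_infty_comp_unbounded (R : realType) (f : R -> R) (y : R) :
  {homo f : a b / a <= b} -> (forall u, C_infty u -> C_infty (u \o f)) ->
  exists x, y <= f x.
Proof.
move=> fm fC; apply: contrapT => /forallNP fy.
have {}fy x : f x < y by rewrite ltNge; apply/negP/fy.
have [_ [+ _]] := fC _ (bump_C_infty (y + 1)).
(* For [x >= 0], [k = y + 1 - f x] lies in [[1, d]], where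
   [k / (1 + k ^+ 2) >= 1 / (1 + d ^+ 2)]. *)
set d := y + 1 - f 0; have d1 : 1 < d by have := fy 0; rewrite /d; lra.
move=> /cvgrPdist_lt/(_ (1 + d ^+ 2)^-1); rewrite invr_gt0 ltr_wpDr ?sqr_ge0//.
move=> /(_ isT) [M [_ small]].
have [] := pselect (exists x, M < x /\ 0 <= x); last first.
  by move=> []; exists (Num.max (M + 1) 0); rewrite le_max lexx orbT lt_max ltrDl ltr01.
move=> [x [Mx x0]]; have := small x Mx.
have := fy x; have := fm _ _ x0.
rewrite sub0r normrN /= normrM normfV.
set g := f x => f0g gy; rewrite ltr0_norm ?gtr0_norm; try by nra.
rewrite ltr_pdivrMr; last by nra.
rewrite mulrC ltr_pdivlMr; last by nra.
have : g - (y + 1) = - (y + 1 - g) by rewrite opprB.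
have : 1 <= y + 1 - g by lra.
have : y + 1 - g <= d by rewrite /d; lra.
move: (y + 1 - g) => k kd k1 ->.
by nra.
Qed.

Lemma C_infty_comp_surjective (R : realType) (f : R -> R) :
  {homo f : x y / x <= y} -> (forall u, C_infty u -> C_infty (u \o f)) ->
  forall y, exists x, f x = y.
Proof.
move=> fm fC y.
have [b yb] := C_infty_comp_unbounded y fm fC.
have [|u uC|a ya] := @C_infty_comp_unbounded R (fun x => - f (- x)) (- y).
- by move=> p q pq; rewrite lerN2; apply: fm; rewrite lerN2.
- have refl (v : R -> R) : C_infty v -> C_infty (fun x => v (- x)).
    move=> [vc [vy vNy]]; split; [|split].
    + by move=> x; apply: continuous_comp; [exact: opp_continuous|exact: vc].
    + apply: cvg_comp vNy; apply/cvgrNyPle => A; near=> x; rewrite lerNl.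
      by near: x; exact: (nbhs_pinfty_ge (num_real _)).
    + apply: cvg_comp vy; apply/cvgryPge => A; near=> x; rewrite lerNr.
      by near: x; exact: (nbhs_ninfty_le (num_real _)).
  by have /fC/refl := refl _ uC.
rewrite lerN2 in ya.
(* Continuity is known only for composites with [f], so the intermediate value theorem is applied to
   the bump at [y], whose composite has the sign of [f x - y]. *)
have [wc _] := fC _ (bump_C_infty y).
have sgn x : 0 < (1 + (f x - y) ^+ 2)^-1 by rewrite invr_gt0 ltr_wpDr ?sqr_ge0.
have [ab|/ltW ba] := leP (- a) b; last first.
  by exists b; apply/eqP; rewrite eq_le yb (le_trans (fm _ _ ba)).
have [|c _] := @IVT R _ (- a) b 0 ab (continuous_subspaceT wc).
  rewrite /= ge_min le_max; apply/andP; split; apply/orP; [left|right].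
    by rewrite pmulr_lle0 // subr_le0.
  by rewrite pmulr_lge0 // subr_ge0.
move=> /= /eqP; rewrite mulf_eq0 (gt_eqF (sgn c)) orbF subr_eq0 => /eqP.
by exists c.
Unshelve. all: by end_near. Qed.

(** * Strong continuity and the reduction to surjectivity *)

(** Paths near a point are squeezed between two neighbouring paths, so convergence is locally
    uniform, hence uniform on a segment by compactness. Monotonicity keeps paths started in the
    tails where [u] is small. *)
Lemma semigroup_strongly_continuous (R : realType) (X : R -> R -> R)
    (u : R -> R) :
  deterministic_hunt X -> C_infty u ->
  sup_norm (semigroup X t u \- u) @[t --> 0^'+] --> 0%E.
Proof.
move=> hX [uc [uy uNy]]; have [[X0 _] Xc] := hX.
have Xr x : X x t @[t --> 0^'+] --> x.
  by have /continuous_within_itvcyP[_] := Xc x; rewrite X0.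
suff unif (e : R) : 0 < e -> \forall t \near 0^'+, forall x, `|u (X x t) - u x| <= e.
  have unifE (e : R) : 0 < e -> \forall t \near 0^'+,
      (0 <= sup_norm (semigroup X t u \- u)%R <= e%:E)%E.
    move=> e0; near=> t; apply/andP; split.
      apply: le_trans (ereal_sup_ubound _); last by exists 0.
      by rewrite lee_fin.
    apply: ge_ereal_sup => _ [x _ <-]; rewrite lee_fin.
    by move: x; near: t; exact: unif.
  apply/fine_cvgP; split.
    near=> t; have /andP[s0 s1] : (0 <= sup_norm (semigroup X t u \- u)%R <= 1%:E)%E.
      by near: t; exact: unifE.
    by rewrite ge0_fin_numE // (le_lt_trans s1) // ltry.
  apply/cvgrPdist_le => e e0; near=> t; rewrite sub0r normrN /=.
  have /andP[s0 s1] : (0 <= sup_norm (semigroup X t u \- u)%R <= e%:E)%E.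
    by near: t; exact: unifE.
  rewrite ger0_norm ?fine_ge0 // -lee_fin fineK // ge0_fin_numE //.
  by rewrite (le_lt_trans s1) // ltry.
move=> e0; have e20 : 0 < e / 2 by rewrite divr_gt0.
have /cvgrPdist_le/(_ _ e20)[M [_ uM]] := uy.
have /cvgrPdist_le/(_ _ e20)[N [_ uN]] := uNy.
have /compact_near_coveringP cov := @segment_compact R (N - 2) (M + 2).
have local x : `[N - 2, M + 2]%classic x ->
    \forall x' \near x & t \near 0^'+, `|u (X x' t) - u x'| <= e.
  move=> _; have /cvgrPdist_le/(_ _ e20)[d /= d0 ud] := uc x.
  have d20 : 0 < d / 2 by rewrite divr_gt0.
  (* Up to small times [t] the paths from [x - d / 2] and [x + d / 2] move by less than [d / 2], so
     all paths between them are within [d] of [x]. *)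
  have /cvgrPdist_lt/(_ _ d20) xl := Xr (x - d / 2).
  have /cvgrPdist_lt/(_ _ d20) xr := Xr (x + d / 2).
  near=> x' t.
  have t0 : 0 <= t by near: t; exact: nbhs_right_ge.
  have : `|x - x'| < d / 2 by near: x'; exact: nbhsx_ballx.
  have : `|x - d / 2 - X (x - d / 2) t| < d / 2 by near: t; exact: xl.
  have : `|x + d / 2 - X (x + d / 2) t| < d / 2 by near: t; exact: xr.
  rewrite !ltr_distlC => /andP[_ Xr2] /andP[Xl1 _] /andP[x1 x2].
  have Xl := path_monotone hX t0 (ltW x1).
  have Xu := path_monotone hX t0 (ltW x2).
  have xd : `|x - x'| < d by rewrite ltr_distlC; lra.
  have Xd : `|x - X x' t| < d by rewrite ltr_distlC; lra.
  have := ud _ xd; have := ud _ Xd.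
  rewrite -[u (X x' t) - _](subrKA (u x)) distrC => h1 h2.
  by rewrite (splitr e) (le_trans (ler_normD _ _)) ?lerD // distrC.
have {}cov := cov _ _ _ _ local.
(* The margin 1 keeps all paths started below [N - 1] under [N], and all those started above [M + 1]
   over [M], for the same small [t]. *)
have xN : \forall t \near 0^'+, X (N - 1) t < N.
  by apply: (cvgr_lt _ (Xr (N - 1))); rewrite ltrBlDr ltrDl.
have xM : \forall t \near 0^'+, M < X (M + 1) t.
  by apply: (cvgr_gt _ (Xr (M + 1))); rewrite ltrDl.
near=> t => x.
have t0 : 0 <= t by near: t; exact: nbhs_right_ge.
have tail y z : `|0 - u y| <= e / 2 -> `|0 - u z| <= e / 2 -> `|u y - u z| <= e.
  rewrite !sub0r !normrN => uye uze.
  by rewrite (splitr e) (le_trans (ler_normB _ _)) // lerD.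
have [xN1|N1x] := leP x (N - 1).
  apply: tail; apply: uN; last by lra.
  apply: (le_lt_trans (path_monotone hX t0 xN1)); near: t; exact: xN.
have [M1x|xM1] := leP (M + 1) x.
  apply: tail; apply: uM; last by lra.
  apply: lt_le_trans (path_monotone hX t0 M1x); near: t; exact: xM.
have xK : `[N - 2, M + 2]%classic x by rewrite /= in_itv /=; lra.
by move: x xK {N1x xM1}; near: t; exact: cov.
Unshelve. all: by end_near. Qed.

Lemma feller_surjective (R : realType) (X : R -> R -> R) :
  deterministic_hunt X ->
  feller X <-> forall t, 0 <= t -> forall y, exists x, X x t = y.
Proof.
move=> hX; split=> [[F1 _] t t0|surj].
  apply: (@C_infty_comp_surjective R (X^~ t)) => [x y|u uC].
    exact: path_monotone.
  exact: F1.
split=> [t u t0 uC|u]; last exact: semigroup_strongly_continuous.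
apply: (@surjective_C_infty R (X^~ t)) => // [x y|]; first exact: path_monotone.
exact: surj.
Qed.

(** * Ends of time intervals *)

Lemma right_end_infty (R : realType) (I : set R) :
  I 0 -> right_end I \isn't a fin_num -> forall M, exists2 t, I t & M < t.
Proof.
move=> I0 nfin M; apply: contrapT => noM.
have rM : (right_end I <= M%:E)%E.
  apply: ge_ereal_sup => _ [t It <-]; rewrite lee_fin leNgt; apply/negP => Mt.
  by apply: noM; exists t.
have r0 : (0 <= right_end I)%E by apply: ereal_sup_ubound; exists 0.
by move: nfin; rewrite ge0_fin_numE // (le_lt_trans rM) // ltry.
Qed.

Lemma left_end_infty (R : realType) (I : set R) :
  left_end I = -oo%E -> forall M, exists2 t, I t & t < M.
Proof.
move=> lI M; have : (left_end I < M%:E)%E by rewrite lI ltNyr.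
by move=> /ereal_inf_lt[_ [t It <-]]; rewrite lte_fin; exists t.
Qed.

Lemma left_end_finite (R : realType) (I : set R) :
  I 0 -> left_end I != -oo%E -> exists a, forall t, I t -> a <= t.
Proof.
move=> I0 lI; have l0 : (left_end I <= 0)%E by apply: ereal_inf_lbound; exists 0.
have lfin : left_end I \is a fin_num.
  by rewrite fin_numE lI /=; apply: contraTneq l0 => ->.
exists (fine (left_end I)) => t It.
by rewrite -lee_fin fineK //; apply: ereal_inf_lbound; exists t.
Qed.

(** * Order of the domains *)

Lemma domain_cover (R : realType) (D : domains R) (x : R) :
  ordered_partition D -> exists2 j, indices D j & domain D j x.
Proof. by move=> [_ [_ cov]]; have : [set: R] x by []; rewrite -cov. Qed.

Lemma domain_le (R : realType) (D : domains R) (i j : int) (x y : R) :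
  ordered_partition D -> indices D i -> indices D j ->
  domain D i x -> domain D j y -> x <= y -> i <= j.
Proof.
move=> [_ [ord _]] Di Dj Dix Djy; rewrite !leNgt; apply: contra => ji.
exact: ord Dj Di ji Djy Dix.
Qed.

Lemma domain_inj (R : realType) (D : domains R) (i j : int) (x : R) :
  ordered_partition D -> indices D i -> indices D j ->
  domain D i x -> domain D j x -> i = j.
Proof.
move=> oD Di Dj Dix Djx.
by apply/eqP; rewrite eq_le !(domain_le oD _ _ _ _ (lexx x)).
Qed.

(** The domain of [z] has index [j] or [j + 1], and lying below the minimum [e] excludes the latter.
    This supplies the gap-free range demanded by [exit_increasing]. *)
Lemma domain_fill_up (R : realType) (D : domains R) (j : int) (x e z : R) :
  ordered_partition D -> indices D j -> indices D (j + 1) ->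
  domain D j x -> domain D (j + 1) e -> lbound (domain D (j + 1)) e ->
  x <= z -> z < e -> domain D j z.
Proof.
move=> oD Dj Dj1 Djx De lbe xz ze.
have [k Dk Dkz] := domain_cover z oD.
have jk := domain_le oD Dj Dk Djx Dkz xz.
have kj := domain_le oD Dk Dj1 Dkz De (ltW ze).
have [jk'|kj'] : k = j \/ k = j + 1 by lia.
  by rewrite -jk'.
by move: Dkz; rewrite kj' => /lbe; rewrite leNgt ze.
Qed.

Lemma domain_fill_down (R : realType) (D : domains R) (j : int) (x e z : R) :
  ordered_partition D -> indices D j -> indices D (j - 1) ->
  domain D j x -> domain D (j - 1) e -> ubound (domain D (j - 1)) e ->
  z <= x -> e < z -> domain D j z.
Proof.
move=> oD Dj Dj1 Djx De ube zx ez.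
have [k Dk Dkz] := domain_cover z oD.
have kj := domain_le oD Dk Dj Dkz Djx zx.
have jk := domain_le oD Dj1 Dk De Dkz (ltW ez).
have [jk'|kj'] : k = j \/ k = j - 1 by lia.
  by rewrite -jk'.
by move: Dkz; rewrite kj' => /ube; rewrite leNgt ez.
Qed.

(** The supremum of the lower domain lies in one of the two, as maximum of the lower or minimum of
    the upper. *)
Lemma adjacent_domains_endpoint (R : realType) (D : domains R) (j : int) :
  ordered_partition D -> indices D j -> indices D (j + 1) ->
  (forall x, domain D j x -> exists2 y, domain D j y & x < y) ->
  (forall x, domain D (j + 1) x -> exists2 y, domain D (j + 1) y & y < x) ->
  False.
Proof.
move=> oD Dj Dj1 nomax nomin.
have [[[_ [x0 Dx0]] [_ [x1 Dx1]]] ord] := (oD.1 _ Dj, oD.1 _ Dj1, oD.2.1).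
have below x y : domain D j x -> domain D (j + 1) y -> x < y.
  by apply: ord => //; rewrite ltrDl.
have ub y : domain D (j + 1) y -> ubound (domain D j) y.
  by move=> Dy x Dx; exact/ltW/below.
set b := sup (domain D j).
have b_ub : ubound (domain D j) b by apply: ub_le_sup; exists x1; exact: ub.
have b_le y : domain D (j + 1) y -> b <= y.
  by move=> Dy; apply: ge_sup; [exists x0|exact: ub].
have [k Dk Dkb] := domain_cover b oD.
have jk := domain_le oD Dj Dk Dx0 Dkb (b_ub _ Dx0).
have kj := domain_le oD Dk Dj1 Dkb Dx1 (b_le _ Dx1).
have [kE|kE] : k = j \/ k = j + 1 by lia.
  by move: Dkb; rewrite kE => /nomax[y /b_ub yb]; rewrite ltNge yb.
by move: Dkb; rewrite kE => /nomin[y /b_le yb]; rewrite ltNge yb.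
Qed.

(** * Surjectivity in terms of left ends *)

Lemma moving_domain (R : realType) (X : R -> R -> R) (D : domains R) (j : int) :
  domain_spec X D j -> dtype D j <> Odot ->
  [/\ is_interval (time_itv D j), time_itv D j 0,
      Phi D j @` time_itv D j = domain D j,
      {in time_itv D j &, injective (Phi D j)} &
      flows_along X (time_itv D j) (Phi D j)].
Proof.
rewrite /domain_spec; case: (dtype D j) => // -[gen mono _] _;
  (have inj : {in time_itv D j &, injective (Phi D j)}
     by [exact: increasing_inj | exact: decreasing_inj]);
  by have flow := generates_flows inj gen; case: gen.
Qed.

Lemma exit_to_odot (R : realType) (X : R -> R -> R) (D : domains R) (j : int) :
  deterministic_hunt X -> decomposition X D -> indices D j ->
  dtype D j <> Odot -> forall s t, time_itv D j s -> 0 <= t ->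
  ~ time_itv D j (s + t) ->
  exists i, [/\ indices D i, dtype D i = Odot & domain D i (X (Phi D j s) t)].
Proof.
move=> hX [oD spec _] Dj nodot s t Is t0 nIst.
have sj := spec _ Dj.
have [itvI I0 IJ inj flow] := moving_domain sj nodot.
have DPhi r : time_itv D j r -> domain D j (Phi D j r).
  by move=> Ir; rewrite -IJ; exists r.
(* An infinite right end would put [s + t] in the time interval. *)
have fin : right_end (time_itv D j) \is a fin_num.
  apply: contrapT => /negP/(right_end_infty I0)/(_ (s + t))[r Ir str].
  by apply: nIst; apply: (itvI s r) => //; rewrite lerDl t0 ltW.
move: sj nodot; rewrite /domain_spec; case dE: (dtype D j) => // [] [_ mono].
- move=> /(_ fin)[Dj1 dj1 [e [De lbe abs]]] _; exists (j + 1); split => //.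
  have rest h : 0 <= h -> X e h = e.
    by have := spec _ Dj1; rewrite /domain_spec dj1; apply.
  rewrite (@exit_increasing R X _ _ e hX itvI flow mono rest) //.
  + by move=> r /DPhi Dr; apply: oD.2.1 Dr De => //; rewrite ltrDl.
  + by move=> r z /DPhi Dr; rewrite IJ; exact: domain_fill_up De lbe.
  + by rewrite IJ.
- move=> /(_ fin)[Dj1 dj1 [e [De ube abs]]] _; exists (j - 1); split => //.
  have rest h : 0 <= h -> X e h = e.
    by have := spec _ Dj1; rewrite /domain_spec dj1; apply.
  rewrite (@exit_decreasing R X _ _ e hX itvI flow mono rest) //.
  + by move=> r /DPhi Dr; apply: oD.2.1 De Dr => //; rewrite gtrBl.
  + by move=> r z /DPhi Dr; rewrite IJ; exact: domain_fill_down De ube.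
  + by rewrite IJ.
Qed.

Lemma surjective_left_end (R : realType) (X : R -> R -> R) (D : domains R) :
  deterministic_hunt X -> decomposition X D ->
  (forall t, 0 <= t -> forall y, exists x, X x t = y) <->
  (forall j, indices D j -> dtype D j <> Odot ->
     left_end (time_itv D j) = -oo%E).
Proof.
move=> hX hD; have [oD spec _] := hD; split=> [surj j Dj nodot|left t t0 y].
  have [itvI I0 IJ inj flow] := moving_domain (spec _ Dj) nodot.
  apply: contrapT => /eqP/(left_end_finite I0)[a aI].
  have a0 := aI _ I0.
  (* As [a] bounds the time interval below, a path of this domain at [Phi D j 0] after time [1 - a]
     would have started at parameter [a - 1 < a]. *)
  have t0 : 0 <= 1 - a by lra.
  have [x xt] := surj _ t0 (Phi D j 0).
  have Dj0 : domain D j (Phi D j 0) by rewrite -IJ; exists 0.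
  have [k Dk Dkx] := domain_cover x oD.
  (* A start in an [Odot]-domain never moves; one in a moving domain either stays there, forcing
     [k = j], or ends in an [Odot]-domain. *)
  have [kodot|knodot] := pselect (dtype D k = Odot).
    have := spec _ Dk; rewrite /domain_spec kodot => /(_ x _ Dkx t0).
    rewrite xt => xE; move: Dkx; rewrite -xE => Dkx.
    by have kj := domain_inj oD Dk Dj Dkx Dj0; rewrite -kj kodot in nodot.
  have [_ _ IJk _ flowk] := moving_domain (spec _ Dk) knodot.
  move: Dkx; rewrite -IJk => -[s Is xE]; rewrite -xE in xt.
  have [Ist|nIst] := pselect (time_itv D k (s + (1 - a))).
    have : domain D k (Phi D j 0).
      by rewrite -xt flowk // -IJk; exists (s + (1 - a)).
    move=> /(domain_inj oD Dj Dk Dj0) jk; subst k.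
    have := inj (s + (1 - a)) 0; rewrite !inE -flow // xt => /(_ Ist I0 erefl).
    by have := aI _ Is; lra.
  have [i [Di iodot]] := exit_to_odot hX hD Dk knodot Is t0 nIst.
  rewrite xt => /(domain_inj oD Dj Di Dj0) ji.
  by rewrite ji iodot in nodot.
have [j Dj Djy] := domain_cover y oD.
have [odot|nodot] := pselect (dtype D j = Odot).
  by exists y; have := spec _ Dj; rewrite /domain_spec odot; apply.
have [itvI I0 IJ inj flow] := moving_domain (spec _ Dj) nodot.
move: Djy; rewrite -IJ => -[s Is <-].
(* A preimage is found by running the generating path back by [t], which the infinite left end
   permits. *)
have [r Ir rs] := left_end_infty (left _ Dj nodot) (s - t).
have Ist : time_itv D j (s - t).
  by apply: (itvI r s) => //; rewrite (ltW rs) gerBl.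
by exists (Phi D j (s - t)); rewrite flow ?subrK.
Qed.

(** * Left ends and building blocks *)

(** [Phi] grows towards the future for [Oplus] and towards the past for [Ominus]; time is unbounded
    on that side. *)
Lemma no_max_domain (R : realType) (X : R -> R -> R) (D : domains R) (j : int) :
  domain_spec X D j ->
  (dtype D j = Oplus /\ right_end (time_itv D j) \isn't a fin_num) \/
  (dtype D j = Ominus /\ left_end (time_itv D j) = -oo%E) ->
  forall x, domain D j x -> exists2 y, domain D j y & x < y.
Proof.
move=> sj cases x; have nodot : dtype D j <> Odot by case: cases => -[->].
have [itvI I0 IJ _ _] := moving_domain sj nodot.
rewrite -IJ => -[s Is <-].
suff [t It st] : exists2 t, time_itv D j t & Phi D j s < Phi D j t.
  by exists (Phi D j t) => //; exists t.
move: sj; rewrite /domain_spec; case: cases => -[-> end_j] [_ mono _].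
- by have [t It st] := right_end_infty I0 end_j s; exists t => //; exact: mono.
- by have [t It st] := left_end_infty end_j s; exists t => //; exact: mono.
Qed.

Lemma no_min_domain (R : realType) (X : R -> R -> R) (D : domains R) (j : int) :
  domain_spec X D j ->
  (dtype D j = Ominus /\ right_end (time_itv D j) \isn't a fin_num) \/
  (dtype D j = Oplus /\ left_end (time_itv D j) = -oo%E) ->
  forall x, domain D j x -> exists2 y, domain D j y & y < x.
Proof.
move=> sj cases x; have nodot : dtype D j <> Odot by case: cases => -[->].
have [itvI I0 IJ _ _] := moving_domain sj nodot.
rewrite -IJ => -[s Is <-].
suff [t It st] : exists2 t, time_itv D j t & Phi D j t < Phi D j s.
  by exists (Phi D j t) => //; exists t.
move: sj; rewrite /domain_spec; case: cases => -[-> end_j] [_ mono _].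
- by have [t It st] := right_end_infty I0 end_j s; exists t => //; exact: mono.
- by have [t It st] := left_end_infty end_j s; exists t => //; exact: mono.
Qed.

Lemma left_end_building_block (R : realType) (X : R -> R -> R) (D : domains R)
    (j : int) :
  decomposition X D ->
  (forall j, indices D j -> dtype D j <> Odot ->
     left_end (time_itv D j) = -oo%E) ->
  indices D j -> indices D (j + 1) -> building_block D j.
Proof.
move=> [oD spec merged] left Dj Dj1.
have [sj sj1] := (spec _ Dj, spec _ Dj1).
have := merged _ Dj Dj1; rewrite /building_block.
have gap := adjacent_domains_endpoint oD Dj Dj1.
(* Absorption in finite time needs an [Odot] neighbour ahead, so a domain heading for a moving
   neighbour has infinite right end. *)
have noright_j : dtype D j = Oplus -> dtype D (j + 1) <> Odot ->
    right_end (time_itv D j) \isn't a fin_num.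
  move=> dj dj1; apply/negP => fin; move: sj; rewrite /domain_spec dj.
  by move=> [_ _ /(_ fin)[_ dj1' _]]; rewrite dj1' in dj1.
have noright_j1 : dtype D (j + 1) = Ominus -> dtype D j <> Odot ->
    right_end (time_itv D (j + 1)) \isn't a fin_num.
  move=> dj1 dj; apply/negP => fin; move: sj1; rewrite /domain_spec dj1.
  by move=> [_ _ /(_ fin)]; rewrite addrK => -[_ dj' _]; rewrite dj' in dj.
have [leftj leftj1] := (left _ Dj, left _ Dj1).
(* Of the nine pairs, two [Odot] are excluded by merging and the four with one [Odot] are the
   building blocks. In the four moving pairs the lower domain has no maximum and the upper no
   minimum. *)
case dj: (dtype D j) noright_j noright_j1 leftj => nrj nrj1 leftj;
  case dj1: (dtype D (j + 1)) nrj nrj1 leftj1 => nrj nrj1 leftj1 nm;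
  try by [|apply: nm|apply: leftj|apply: leftj1];
  apply: gap; try by [apply: (no_max_domain sj); left; split=> //; apply: nrj
    | apply: (no_max_domain sj); right; split=> //; apply: leftj
    | apply: (no_min_domain sj1); left; split=> //; apply: nrj1
    | apply: (no_min_domain sj1); right; split=> //; apply: leftj1].
Qed.

(** The neighbour behind the motion decides: the lower one for [Oplus], the upper one for [Ominus].
    The only block with that orientation carries the left end condition, and without such a
    neighbour the domain is lowest or highest. *)
Lemma building_block_left_end (R : realType) (D : domains R) :
  (pure_type D \/
   forall j : int, indices D j -> indices D (j + 1) -> building_block D j) ->
  (forall n : nat, lowest D = Some n -> dtype D (- n%:Z) = Oplus ->
      left_end (time_itv D (- n%:Z)) = -oo%E) ->
  (forall m : nat, highest D = Some m -> dtype D m%:Z = Ominus ->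
      left_end (time_itv D m%:Z) = -oo%E) ->
  forall j, indices D j -> dtype D j <> Odot ->
    left_end (time_itv D j) = -oo%E.
Proof.
move=> blocks low high j Dj nodot.
case dj: (dtype D j) nodot => // _.
- have [Dj1|nDj1] := pselect (indices D (j - 1)).
    case: blocks => [pure|block]; first by have := pure _ _ Dj Dj1; lia.
    have := block (j - 1); rewrite /building_block subrK dj => /(_ Dj1 Dj).
    by case: (dtype D (j - 1)).
  move: nDj1 Dj low; rewrite /indices /=; case: (lowest D) => [n|] nDj1 Dj low.
    have jE : j = - n%:Z.
      apply: contrapT => jn; apply: nDj1; case: (highest D) Dj => [m|]; lia.
    by rewrite jE in dj *; exact: low.
  by exfalso; apply: nDj1; case: (highest D) Dj => [m|] //; lia.
- have [Dj1|nDj1] := pselect (indices D (j + 1)).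
    case: blocks => [pure|block]; first by have := pure _ _ Dj Dj1; lia.
    have := block j; rewrite /building_block dj => /(_ Dj Dj1).
    by case: (dtype D (j + 1)).
  move: nDj1 Dj high; rewrite /indices /=; case: (highest D) => [m|] nDj1 Dj high.
    have jE : j = m%:Z.
      apply: contrapT => jm; apply: nDj1; case: (lowest D) Dj => [n|]; lia.
    by rewrite jE in dj *; exact: high.
  by exfalso; apply: nDj1; case: (lowest D) Dj => [n|] //; lia.
Qed.

Theorem theorem3p5 (R : realType) (X : R -> R -> R) (D : domains R)
    (hX : deterministic_hunt X) (hD : decomposition X D) :
  feller X <->
  (pure_type D \/
   forall j : int, indices D j -> indices D (j + 1) -> building_block D j) /\
  ((forall n : nat, lowest D = Some n -> dtype D (- n%:Z) = Oplus ->
      left_end (time_itv D (- n%:Z)) = -oo%E) /\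
   (forall m : nat, highest D = Some m -> dtype D m%:Z = Ominus ->
      left_end (time_itv D m%:Z) = -oo%E)).
Proof.
apply: (iff_trans (feller_surjective hX)).
apply: (iff_trans (surjective_left_end hX hD)).
split=> [left|[blocks [low high]]]; last exact: building_block_left_end.
split; first by right=> j Dj Dj1; exact: left_end_building_block hD left Dj Dj1.
split=> [n lo|m hi] dE; apply: left; rewrite ?dE //.
- split; rewrite ?lo //; case: (highest D) => // m; lia.
- split; rewrite ?hi //; case: (lowest D) => // n; lia.
Qed.
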